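(* Let $n\geq 2$ be an integer and let $\mathbb{F}$ be a field with $|\mathbb{F}|\geq 4\lfloor\frac{n}{2}\rfloor+5$. Then every matrix in $SL_n(\mathbb{F})$ is a product of at most three commutators of $\mathcal{U}_2$-matrices, and is a product of at most six $\mathcal{U}_2$-matrices. In addition, if $\mathbb{F}$ is algebraically closed, then every matrix in $SL_n(\mathbb{F})$ is a product of at most two commutators of $\mathcal{U}_2$-matrices, and is a product of at most four $\mathcal{U}_2$-matrices.
   Context: $SL_n(\mathbb{F})$ is the group of $n\times n$ matrices over $\mathbb F$ with determinant $1$. The field may be finite or infinite; infinite fields satisfy any lower bound on $|\mathbb F|$. A matrix $X\in M_n(\mathbb{F})$ is a $\mathcal{U}_2$-matrix (unipotent matrix of index $2$) if $(X-I_n)^2=0_n$ and $X\neq I_n$. For invertible $X,Y$, $[X,Y]:=XYX^{-1}Y^{-1}$. A commutator of $\mathcal{U}_2$-matrices is a matrix of the form $[X,Y]$ where both $X,Y\in M_n(\mathbb{F})$ are $\mathcal{U}_2$-matrices. $\lfloor x\rfloor$ denotes the floor of $x$. *)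

(* Defs.v *)
From mathcomp Require Import all_boot all_order all_algebra.

Set Implicit Arguments.
Unset Strict Implicit.
Unset Printing Implicit Defensive.

Import GRing.Theory.
Local Open Scope ring_scope.

(* [T] may be infinite, so [#|T|] is not available. *)
Definition card_at_least (N : nat) (T : Type) : Prop :=
  exists f : 'I_N -> T, injective f.

Definition U2_matrix (F : fieldType) (n : nat) (X : 'M[F]_n) : Prop :=
  (X - 1%:M) ^+ 2 = 0 /\ X <> 1%:M.

(* Only used for invertible arguments; [invmx] is the identity elsewhere. *)
Definition mx_commutator (F : fieldType) (n : nat) (X Y : 'M[F]_n) : 'M[F]_n :=
  X *m Y *m invmx X *m invmx Y.

Definition U2_commutator (F : fieldType) (n : nat) (A : 'M[F]_n) : Prop :=
  exists X Y : 'M[F]_n,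
    [/\ U2_matrix X, U2_matrix Y & A = mx_commutator X Y].

(* The empty product is excluded. *)
Definition product_of_at_most (F : fieldType) (n k : nat)
    (P : 'M[F]_n -> Prop) (A : 'M[F]_n) : Prop :=
  exists s : seq 'M[F]_n,
    [/\ (0 < size s <= k)%N, {in s, forall X, P X}
      & A = \big[mulmx/1%:M]_(X <- s) X].

(* Main.v *)
(* If [s^4 <> 1] then [diag (s^2, s^-2)] is a commutator of U_2-matrices of size
   2, so a matrix whose spectrum consists of distinct pairs [s^2, s^-2], together
   with [1] in odd size, is a commutator of U_2-matrices. By Sourour's theorem a
   nonscalar matrix of determinant 1 is a product of two matrices with that
   spectrum. A scalar matrix becomes nonscalar after multiplication by such a
   commutator, which costs a third factor. Over an algebraically closed field a
   scalar matrix [a] with [a^n = 1] is itself a quotient [(a B) B^-1], where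
   [B] is diagonal and [a B] is a permutation of [B]. *)
Require Import Defs.
From mathcomp Require Import all_boot all_order all_algebra.
From mathcomp Require Import perm ring zify.

Set Implicit Arguments.
Unset Strict Implicit.
Unset Printing Implicit Defensive.

Import GRing.Theory.
Local Open Scope ring_scope.

(** * Similarity, and diagonal matrices given by a list of entries *)

(** The intertwining form allows a similarity to be checked without computing an inverse. *)
Definition mxsim (F : fieldType) n (A B : 'M[F]_n) : Prop :=
  exists2 P, P \in unitmx & P *m A = B *m P.

(** Lists give access to [uniq], [perm_eq] and big products. Entries beyond the end of [l] read as
    [0], which is why the size of the list is often a hypothesis. *)
Definition diag_seq (F : fieldType) n (l : seq F) : 'M[F]_n :=
  diag_mx (\row_(i < n) l`_i).

(* The inverse of [1 + N] is [1 - N] when [N] squares to zero. *)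
Definition square_zero_commutator (F : fieldType) n (A : 'M[F]_n) : Prop :=
  exists N M : 'M[F]_n, [/\ N *m N = 0, M *m M = 0
    & A = (1%:M + N) *m (1%:M + M) *m (1%:M - N) *m (1%:M - M)].

Lemma mxsim_refl (F : fieldType) n (A : 'M[F]_n) : mxsim A A.
Proof. by exists 1%:M; rewrite ?unitmx1 ?mul1mx ?mulmx1. Qed.

Lemma mxsim_sym (F : fieldType) n (A B : 'M[F]_n) : mxsim A B -> mxsim B A.
Proof.
case=> P uP e; exists (invmx P); first by rewrite unitmx_inv.
apply: (can_inj (mulKmx uP)); rewrite !mulmxA mulmxV // mul1mx e.
by rewrite -mulmxA mulmxV // mulmx1.
Qed.

Lemma mxsim_trans (F : fieldType) n (A B C : 'M[F]_n) :
  mxsim A B -> mxsim B C -> mxsim A C.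
Proof.
case=> P uP eP [Q uQ eQ]; exists (Q *m P); first by rewrite unitmx_mul uQ.
by rewrite -mulmxA eP mulmxA eQ mulmxA.
Qed.

Lemma mxsim_conj (F : fieldType) n (P A : 'M[F]_n) :
  P \in unitmx -> mxsim A (P *m A *m invmx P).
Proof. by move=> uP; exists P; rewrite // mulmxKV. Qed.

Lemma mxsimP (F : fieldType) n (A B : 'M[F]_n) :
  mxsim A B -> exists2 P, P \in unitmx & B = P *m A *m invmx P.
Proof. by case=> P uP e; exists P; rewrite // e mulmxK. Qed.

Lemma mxsim_det (F : fieldType) n (A B : 'M[F]_n) : mxsim A B -> \det A = \det B.
Proof.
move=> [P uP e]; have := congr1 determinant e; rewrite !det_mulmx mulrC.
by apply: mulIf; rewrite -unitfE -unitmxE.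
Qed.

(** Both factors are conjugated by the same matrix, so a factorization may be sought after any
    change of basis. *)
Lemma mxsim_factor (F : fieldType) n (A A' B C : 'M[F]_n) :
  mxsim A A' -> A' = B *m C ->
  exists B' C', [/\ A = B' *m C', mxsim B' B & mxsim C' C].
Proof.
move=> /mxsim_sym /mxsimP[P uP ->] ->.
exists (P *m B *m invmx P), (P *m C *m invmx P); split.
- by rewrite !mulmxA mulmxKV.
- by apply/mxsim_sym/mxsim_conj.
- by apply/mxsim_sym/mxsim_conj.
Qed.

Lemma mxsim_diag_block (F : fieldType) m n (A A' : 'M[F]_m) (D D' : 'M[F]_n) :
  mxsim A A' -> mxsim D D' -> mxsim (block_mx A 0 0 D) (block_mx A' 0 0 D').
Proof.
move=> [P uP eP] [Q uQ eQ]; exists (block_mx P 0 0 Q).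
  by rewrite unitmxE det_ublock unitrM -!unitmxE uP.
by rewrite !mulmx_block !(mul0mx, mulmx0, addr0, add0r) eP eQ.
Qed.

Lemma mxsim_diag_perm (F : fieldType) n (l l' : seq F) :
  size l = n -> perm_eq l l' -> mxsim (diag_seq n l) (diag_seq n l').
Proof.
move=> /eqP sl; rewrite perm_sym => /(@tuple_permP _ _ l' (Tuple sl)) [s es].
exists (perm_mx s); first by rewrite unitmx_perm.
apply/matrixP => i j; rewrite mul_mx_diag mul_diag_mx !mxE.
have -> : l'`_i = l`_(s i).
  by rewrite es (nth_map i) ?size_enum_ord // nth_ord_enum (tnth_nth 0).
by case: eqVneq => [->|]; rewrite ?mulr1 ?mul1r ?mulr0 ?mul0r.
Qed.

Lemma diag_seq_cat (F : fieldType) m n (l1 l2 : seq F) : size l1 = m ->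
  diag_seq (m + n) (l1 ++ l2) = block_mx (diag_seq m l1) 0 0 (diag_seq n l2).
Proof.
move=> s1; rewrite /diag_seq -diag_mx_row; congr diag_mx.
apply/rowP => i; rewrite !mxE; case: splitP => j ->; rewrite mxE nth_cat s1.
  by rewrite ltn_ord.
by rewrite ltnNge leq_addr addKn.
Qed.

Lemma diag_seq1 (F : fieldType) (x : F) : diag_seq 1 [:: x] = x%:M.
Proof. by apply/matrixP => i j; rewrite !mxE !ord1. Qed.

Lemma diag_seq_cons (F : fieldType) n (x : F) (l : seq F) :
  diag_seq (1 + n) (x :: l) = block_mx x%:M 0 0 (diag_seq n l).
Proof. by rewrite -diag_seq1 -diag_seq_cat. Qed.

Lemma det_diag_seq (F : fieldType) n (l : seq F) : size l = n ->
  \det (diag_seq n l) = \prod_(x <- l) x.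
Proof.
move=> <-; rewrite det_diag (big_nth 0) big_mkord.
by apply: eq_bigr => i _; rewrite mxE.
Qed.

Lemma diag_seq_nonscalar (F : fieldType) n (l : seq F) :
  (1 < n)%N -> size l = n -> uniq l -> ~~ is_scalar_mx (diag_seq n l).
Proof.
case: n => [|[|n]] // _ sl ul; apply/is_scalar_mxP => -[a /matrixP e].
have := e 0 0; have := e 1 1; rewrite !mxE /= !mulr1n => <- /eqP.
by rewrite nth_uniq ?sl.
Qed.

(** As [x] is not an eigenvalue of [D], the matrix [D - x] is invertible, and conjugation by
    [[1 0; v 1]] with [(D - x) v = c] clears the column [c]. *)
Lemma mxsim_lblock_diag (F : fieldType) n (x : F) (l : seq F) c (D : 'M[F]_n) :
  size l = n -> x \notin l -> mxsim D (diag_seq n l) ->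
  mxsim (block_mx x%:M 0 c D) (diag_seq (1 + n) (x :: l)).
Proof.
move=> sl xl sD; rewrite diag_seq_cons.
have uE : D - x%:M \in unitmx.
  suff: diag_seq n l - x%:M \in unitmx.
    case/mxsimP: (sD) => P uP ->.
    have -> : P *m D *m invmx P - x%:M = P *m (D - x%:M) *m invmx P.
      by rewrite mulmxBr mulmxBl scalar_mxC mulmxK.
    by rewrite !unitmx_mul unitmx_inv uP andbT.
  rewrite /diag_seq -diag_const_mx -raddfB unitmxE det_diag unitfE.
  apply/prodf_neq0 => i _; rewrite !mxE subr_eq0; apply: contraNneq xl => <-.
  by rewrite mem_nth ?sl.
apply: mxsim_trans (mxsim_diag_block (mxsim_refl _) sD).
exists (block_mx 1%:M 0 (invmx (D - x%:M) *m c) 1%:M).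
  by rewrite unitmxE det_lblock !det1 mulr1 unitr1.
rewrite !mulmx_block !(mul0mx, mulmx0, mul1mx, mulmx1, addr0, add0r).
congr block_mx; apply: (can_inj (addrK (- (x *: (invmx (D - x%:M) *m c))))).
by rewrite mul_mx_scalar addrAC subrr add0r -mul_scalar_mx -mulmxBl mulKVmx.
Qed.

(** Transpose of the lower triangular case, since diagonal matrices are symmetric. *)
Lemma mxsim_ublock_diag (F : fieldType) n (x : F) (l : seq F) r (D : 'M[F]_n) :
  size l = n -> x \notin l -> mxsim D (diag_seq n l) ->
  mxsim (block_mx x%:M r 0 D) (diag_seq (1 + n) (x :: l)).
Proof.
have tr m (A B : 'M[F]_m) : mxsim A B -> mxsim A^T B^T.
  move=> /mxsim_sym [P uP e]; exists P^T; first by rewrite unitmx_tr.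
  by rewrite -!trmx_mul e.
have trd m s : (@diag_seq F m s)^T = diag_seq m s by apply: tr_diag_mx.
move=> sl xl /tr; rewrite trd => /(mxsim_lblock_diag r^T sl xl) /tr.
by rewrite trd tr_block_mx !trmxK tr_scalar_mx trmx0.
Qed.

(** * Nonscalar matrices up to similarity *)

(** A nonscalar diagonal matrix has two distinct diagonal entries, and conjugating it by the
    transvection [1 + E_ij] puts their difference at position [(i, j)]. *)
Lemma nonscalar_offdiag (F : fieldType) n (A : 'M[F]_n) : ~~ is_scalar_mx A ->
  exists A', mxsim A A' /\ exists i j, i != j /\ A' i j != 0.
Proof.
move=> nsA.
have [/'exists_existsP[i [j /andP[ij Aij]]]|nA] :=
    boolP [exists i, exists j, (i != j) && (A i j != 0)].
  by exists A; split; [exact: mxsim_refl | exists i, j].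
have dA i j : i != j -> A i j = 0.
  move=> ij; apply: contraNeq nA => Aij.
  by apply/'exists_existsP; exists i, j; rewrite ij.
have [i [j Aij]] : exists i j, A i i != A j j.
  case: n => [|n] in A nsA nA dA *; first by rewrite [A]flatmx0 mx0_is_scalar in nsA.
  apply/'exists_existsP; apply: contraR nsA => /existsPn eA.
  apply/is_scalar_mxP; exists (A 0 0); apply/matrixP => i j; rewrite mxE.
  case: eqVneq => [<-|/dA //].
  by have /existsPn/(_ 0)/negPn/eqP := eA i.
have ij : i != j by apply: contraNneq Aij => ->.
pose P : 'M[F]_n := 1%:M + delta_mx i j.
pose Q : 'M[F]_n := 1%:M - delta_mx i j.
have dd : delta_mx i j *m delta_mx i j = 0 :> 'M[F]_n.
  by rewrite mul_delta_mx_0 // eq_sym.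
have PQ : P *m Q = 1%:M.
  by rewrite mulmxBr mulmx1 mulmxDl mul1mx dd addr0 addrK.
have [uP _] := mulmx1_unit PQ.
exists (P *m A *m invmx P); split; first exact: mxsim_conj.
have -> : invmx P = Q by rewrite -[Q](mulKmx uP) PQ mulmx1.
exists i, j; split=> //.
have -> : (P *m A *m Q) i j = A j j - A i i; last by rewrite subr_eq0 eq_sym.
have -> : A = diag_mx (\row_k A k k).
  apply/matrixP => k l; rewrite !mxE.
  by case: (altP (k =P l)) => [->|/dA].
rewrite mul_mx_diag mulmxBr mulmx1 /P !mxE !eqxx (negPf ij) add0r mul1r.
congr (_ - _); rewrite (bigD1 i) //= big1 => [|k ki]; last first.
  by rewrite !mxE (negPf ki) mulr0.
by rewrite !mxE !eqxx (negPf ij) !(addr0, mulr1, mul1r).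
Qed.

(** Exchanging the indices [0] and [j] brings a nonzero off-diagonal entry of column [j] into the
    first column, below the corner. *)
Lemma nonscalar_lower (F : fieldType) m (A : 'M[F]_(1 + m)) :
  ~~ is_scalar_mx A ->
  exists (a : 'M_1) r c D, mxsim A (block_mx a r c D) /\ c != 0.
Proof.
move/nonscalar_offdiag => [A' [sA [i [j [ij Aij]]]]].
pose s : 'S_(1 + m) := tperm 0 j.
pose A2 := row_perm s (col_perm s A').
have sA2 : mxsim A' A2.
  exists (perm_mx s); first by rewrite unitmx_perm.
  by rewrite /A2 col_permE row_permE -!mulmxA -perm_mxM mulVg perm_mx1 mulmx1.
exists (ulsubmx A2), (ursubmx A2), (dlsubmx A2), (drsubmx A2).
rewrite submxK; split; first exact: mxsim_trans sA sA2.
apply: contraNneq Aij => c0.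
have : s i != 0 by rewrite -(tpermR 0 j) (inj_eq perm_inj).
case: (splitP (s i : 'I_(1 + m))) => k ek.
  by move=> /eqP[]; apply: val_inj; rewrite /= ek ord1.
have ei : i = s (rshift 1 k) by rewrite -[i](tpermK 0 j); congr (s _); apply: val_inj.
have ej : j = s (lshift m 0) by rewrite -[LHS](tpermL 0 j); congr (s _); apply: val_inj.
move=> _; have /eqP := congr1 (fun M : 'cV_m => M k 0) c0.
by rewrite !mxE -ei -ej.
Qed.

(** The column [c] is kept while the corner moves by [u c]. Hence the corner can be prescribed when
    [c] is nonzero, and a [u] with [u c = 0] changes only [r] and [D]. *)
Lemma mxsim_unipotent_block (F : fieldType) m (a : 'M[F]_1) r c (D : 'M[F]_m)
    (u : 'rV_m) :
  mxsim (block_mx a r c D)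
    (block_mx (a + u *m c) (r + u *m D - (a + u *m c) *m u) c (D - c *m u)).
Proof.
exists (block_mx 1%:M u 0 1%:M); first by rewrite unitmxE det_ublock !det1 mulr1 unitr1.
rewrite !mulmx_block !(mul0mx, mulmx0, mul1mx, mulmx1, addr0, add0r).
by rewrite !subrKC.
Qed.

Lemma exists_mul_col (F : fieldType) m (c : 'cV[F]_m) (x : F) :
  c != 0 -> exists u : 'rV_m, u *m c = x%:M.
Proof.
case/cV0Pn => i ci; exists ((x / c i 0) *: delta_mx 0 i).
by apply/matrixP => k l; rewrite -scalemxAl -rowE !ord1 !mxE divfK.
Qed.

Lemma exists_annihilator (F : fieldType) m (c : 'cV[F]_m) :
  (1 < m)%N -> exists2 u : 'rV_m, u != 0 & u *m c = 0.
Proof.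
move=> m1; exists (nz_row (kermx c)); last first.
  by apply/sub_kermxP; apply: nz_row_sub.
rewrite nz_row_eq0 -mxrank_eq0 mxrank_ker subn_eq0 -ltnNge.
exact: leq_ltn_trans (rank_leq_col c) m1.
Qed.

Lemma det_schur (F : fieldType) m (a : F) r c (D : 'M[F]_m) : a != 0 ->
  \det (block_mx (a%:M : 'M_1) r c D) = a * \det (D - a^-1 *: (c *m r)).
Proof.
move=> a0.
have -> : block_mx (a%:M : 'M_1) r c D =
    block_mx (a%:M : 'M_1) 0 c 1%:M *m
    block_mx 1%:M (a^-1 *: r) 0 (D - a^-1 *: (c *m r)).
  rewrite mulmx_block !(mul0mx, mulmx0, mul1mx, mulmx1, addr0, add0r).
  by rewrite mul_scalar_mx scalerA divff // scale1r -scalemxAr addrC subrK.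
by rewrite det_mulmx det_lblock det_ublock !det1 det_scalar1 mulr1 mul1r.
Qed.

(* If the Schur complement [S] is scalar, conjugating by [1 u; 0 1] with
   [u c = 0] turns it into [S - a^-1 c u S], which is not. *)
Lemma nonscalar_schur (F : fieldType) m (A : 'M[F]_(1 + m)) (a : F) :
  ~~ is_scalar_mx A -> A \in unitmx -> a != 0 ->
  exists r c D, mxsim A (block_mx (a%:M : 'M_1) r c D) /\
    ((1 < m)%N -> ~~ is_scalar_mx (D - a^-1 *: (c *m r))).
Proof.
move=> nsA uA a0; have [a1 [r1 [c [D1 [sA c0]]]]] := nonscalar_lower nsA.
(* This [u0] moves the corner entry from its present value to [a]. *)
have [u0 eu0] := exists_mul_col (a - a1 0 0) c0.
have := mxsim_trans sA (mxsim_unipotent_block a1 r1 c D1 u0).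
have -> : a1 + u0 *m c = a%:M.
  by rewrite eu0 [X in X + _]mx11_scalar -raddfD addrC subrK.
move: (r1 + _ - _) (D1 - _) => r D {}sA.
have [nsS|] := boolP (is_scalar_mx (D - a^-1 *: (c *m r))); last first.
  by move=> nsS; exists r, c, D.
have [m1|m1] := ltnP 1 m; last by exists r, c, D.
have [s es] := is_scalar_mxP nsS.
(* The determinant of [A] is [a s^m], and [m > 0]. *)
have s0 : s != 0.
  have := uA; rewrite unitmxE (mxsim_det sA) det_schur // es det_scalar.
  apply: contraTneq => ->; rewrite expr0n; case: (m) m1 => // *.
  by rewrite mulr0 unitr0.
have [u u0' uc] := exists_annihilator c m1.
have := mxsim_trans sA (mxsim_unipotent_block a%:M r c D u).
rewrite uc addr0 => sA'; do 3!eexists; split; first exact: sA'.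
move=> _; have -> : D - c *m u - a^-1 *: (c *m (r + u *m D - a%:M *m u))
    = s%:M - (a^-1 * s) *: (c *m u).
  have eD : u *m D = s *: u.
    rewrite -[D](subrK (a^-1 *: (c *m r))) es mulmxDr mul_mx_scalar.
    by rewrite -scalemxAr mulmxA uc mul0mx scaler0 addr0.
  rewrite eD mul_scalar_mx mulmxBr mulmxDr -!scalemxAr scalerBr scalerDr.
  by rewrite !scalerA mulVf // scale1r -es opprB addrA subrK opprD addrA.
apply/negP => /is_scalar_mxP[t et].
have k0 : a^-1 * s != 0 by rewrite mulf_neq0 ?invr_eq0.
(* If the new complement were scalar, [c u] would be a scalar [t']. Then [t' c = c (u c) = 0] gives
   [t' = 0], whereas [c u] is nonzero as a product of a nonzero column and a nonzero row. *)
pose t' := (a^-1 * s)^-1 * (s - t).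
have cuE : c *m u = t'%:M.
  apply: (scalerI k0); rewrite scale_scalar_mx mulrA divff // mul1r raddfB /= -et.
  by rewrite subKr.
have t'0 : t' = 0.
  apply/eqP; have /eqP := mulmxA c u c.
  by rewrite uc mulmx0 cuE mul_scalar_mx eq_sym scaler_eq0 (negPf c0) orbF.
have [i ci] := cV0Pn _ c0; have [j uj] := rV0Pn _ u0'.
have /matrixP/(_ i j)/eqP := cuE; rewrite t'0 raddf0 !mxE big_ord1 mulf_eq0.
by rewrite (negPf ci) (negPf uj).
Qed.

(** * Sourour's factorization with prescribed spectra *)

(** Induction on the size. With [x] and [y] the heads of the two lists, the corner is made equal to
    [x y]. The Schur complement then has the right determinant and factors as [B C], so the whole
    matrix is [[x 0; c/y B] [y r/x; 0 C]]. Distinct eigenvalues make both triangular factors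
    diagonalizable. Size 1 is exempt from the last hypothesis because every matrix of that size is
    scalar. *)
Lemma sourour_factorization (F : fieldType) m (A : 'M[F]_m) (b g : seq F) :
  (0 < m)%N -> size b = m -> size g = m -> uniq b -> uniq g ->
  0 \notin b -> 0 \notin g ->
  \det A = (\prod_(x <- b) x) * \prod_(x <- g) x ->
  ((1 < m)%N -> ~~ is_scalar_mx A) ->
  exists B C, [/\ A = B *m C, mxsim B (diag_seq m b) & mxsim C (diag_seq m g)].
Proof.
case: m A => // m A _; elim: m => [|m IHm] in A b g *.
  case: b g => [|x [|]] // [|y [|]] //= _ _ _ _ _ _.
  rewrite !big_seq1 => dA _; exists x%:M, y%:M.
  rewrite !diag_seq1; split; try exact: mxsim_refl.
  by rewrite [A]mx11_scalar -det_mx11 dA scalar_mxM.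
case: b g => [|x b] // [|y g] //= [sb] [sg] /andP[xb ub] /andP[yg ug].
rewrite !inE !negb_or ![0 == _]eq_sym => /andP[x0 b0] /andP[y0 g0].
rewrite !big_cons => dA /(_ isT) nsA.
have uA : A \in unitmx.
  rewrite unitmxE dA unitfE !mulf_neq0 // prodf_seq_neq0; apply/allP => z zl /=.
    by apply: contraNneq b0 => <-.
  by apply: contraNneq g0 => <-.
have xy0 := mulf_neq0 x0 y0.
have [r [c [D [sA nsS]]]] := nonscalar_schur nsA uA xy0.
have dS : \det (D - (x * y)^-1 *: (c *m r)) = (\prod_(z <- b) z) * \prod_(z <- g) z.
  apply: (mulfI xy0); rewrite -det_schur // -(mxsim_det sA) dA.
  by rewrite mulrACA.
have [B [C [eS sB sC]]] := IHm _ b g sb sg ub ug b0 g0 dS nsS.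
have eA : block_mx ((x * y)%:M : 'M_1) r c D =
    block_mx x%:M 0 (y^-1 *: c) B *m block_mx y%:M (x^-1 *: r) 0 C.
  rewrite mulmx_block !(mul0mx, mulmx0, addr0) -eS -scalar_mxM.
  rewrite mul_scalar_mx mul_mx_scalar !scalerA !divff // !scale1r.
  by rewrite -scalemxAl -scalemxAr scalerA [y^-1 * _]mulrC -invfM subrKC.
have [B' [C' [-> sB' sC']]] := mxsim_factor sA eA.
exists B', C'; split=> //.
  exact: mxsim_trans sB' (mxsim_lblock_diag _ sb xb sB).
exact: mxsim_trans sC' (mxsim_ublock_diag _ sg yg sC).
Qed.

(** * Commutators of [1 + N] and [1 + M] with [N], [M] of square zero, and their spectra *)

Lemma square_zero_commutator1 (F : fieldType) n :
  square_zero_commutator (1%:M : 'M[F]_n).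
Proof. by exists 0, 0; rewrite !mulmx0 !subr0 !addr0 !mulmx1. Qed.

Lemma mulmx_unipotent (F : fieldType) n (N : 'M[F]_n) :
  N *m N = 0 -> (1%:M + N) *m (1%:M - N) = 1%:M.
Proof. by move=> N2; rewrite mulmxBr mulmx1 mulmxDl mul1mx N2 addr0 addrK. Qed.

(** The inverse of [[X, Y]] is [[Y, X]]. *)
Lemma square_zero_commutator_inv (F : fieldType) n (A : 'M[F]_n) :
  square_zero_commutator A ->
  exists2 B, square_zero_commutator B & A *m B = 1%:M.
Proof.
case=> N [M [N2 M2 ->]].
exists ((1%:M + M) *m (1%:M + N) *m (1%:M - M) *m (1%:M - N)); first by exists M, N.
have N1 : (1%:M - N) *m (1%:M + N) = 1%:M by apply/mulmx1C/mulmx_unipotent.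
have M1 : (1%:M - M) *m (1%:M + M) = 1%:M by apply/mulmx1C/mulmx_unipotent.
rewrite !mulmxA -(mulmxA _ _ (1%:M + M)) M1 mulmx1 -(mulmxA _ _ (1%:M + N)) N1 mulmx1.
by rewrite -(mulmxA _ _ (1%:M - M)) mulmx_unipotent // mulmx1 mulmx_unipotent.
Qed.

Lemma square_zero_commutator_sim (F : fieldType) n (A B : 'M[F]_n) :
  mxsim A B -> square_zero_commutator B -> square_zero_commutator A.
Proof.
move=> /mxsim_sym /mxsimP[P uP ->] [N [M [N2 M2 ->]]].
pose c X := P *m X *m invmx P.
have cM X Y : c X *m c Y = c (X *m Y) by rewrite /c !mulmxA mulmxKV.
have cB X Y : c (X - Y) = c X - c Y by rewrite /c mulmxBr mulmxBl.
have cD X Y : c (X + Y) = c X + c Y by rewrite /c mulmxDr mulmxDl.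
have c0 : c 0 = 0 by rewrite /c mulmx0 mul0mx.
have c1 : c 1%:M = 1%:M by rewrite /c mulmx1 mulmxV.
exists (c N), (c M); rewrite !cM N2 M2 c0; split=> //.
by rewrite -/(c _) -!cM !cB !cD c1.
Qed.

Lemma square_zero_commutator_block (F : fieldType) m n (A : 'M[F]_m) (B : 'M[F]_n) :
  square_zero_commutator A -> square_zero_commutator B ->
  square_zero_commutator (block_mx A 0 0 B).
Proof.
case=> N [M [N2 M2 ->]] [N' [M' [N2' M2' ->]]].
exists (block_mx N 0 0 N'), (block_mx M 0 0 M').
rewrite !mulmx_block !(mul0mx, mulmx0, addr0, add0r) N2 N2' M2 M2' block_mx0.
split=> //; rewrite (@scalar_mx_block F m n) !opp_block_mx !oppr0 !add_block_mx.
by rewrite !addr0 !mulmx_block !(mul0mx, mulmx0, addr0, add0r).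
Qed.

(* With [c = s - s^-1], [X = [1 c; 0 1]] and [Y = [1 0; 1 1]], the commutator
   [[X, Y] = [1 + c + c^2, -c^2; c, 1 - c]] has determinant 1 and trace
   [2 + c^2 = s^2 + s^-2]. *)
Lemma square_zero_commutator_diag2 (F : fieldType) (s : F) :
  s != 0 -> s ^+ 4 != 1 ->
  square_zero_commutator (diag_seq 2 [:: s ^+ 2; (s ^+ 2)^-1]).
Proof.
move=> s0 s4; pose c := s - s^-1.
pose mk (a b d e : F) : 'M[F]_2 :=
  \matrix_(i, j) nth 0 (nth [::] [:: [:: a; b]; [:: d; e]] i) j.
have mkE (A : 'M[F]_2) : A = mk (A 0 0) (A 0 1) (A 1 0) (A 1 1).
  apply/matrixP => i j; rewrite !mxE.
  by case: i => [[|[|]]] // ?; case: j => [[|[|]]] // ? /=;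
    congr (A _ _); apply: val_inj.
have mkM a b d e a' b' d' e' : mk a b d e *m mk a' b' d' e' =
   mk (a * a' + b * d') (a * b' + b * e') (d * a' + e * d') (d * b' + e * e').
  rewrite [LHS]mkE; congr mk; by rewrite !mxE !big_ord_recl big_ord0 !mxE /= addr0.
have mk1 : 1%:M = mk 1 0 0 1 by rewrite [LHS]mkE !mxE.
have mk0 : 0 = mk 0 0 0 0 by rewrite [LHS]mkE !mxE.
have mkD a b d e a' b' d' e' : mk a b d e + mk a' b' d' e' =
   mk (a + a') (b + b') (d + d') (e + e').
  by rewrite [LHS]mkE !mxE.
have mkN a b d e : - mk a b d e = mk (- a) (- b) (- d) (- e).
  by rewrite [LHS]mkE !mxE.
have eD : diag_seq 2 [:: s ^+ 2; (s ^+ 2)^-1] = mk (s ^+ 2) 0 0 (s ^+ 2)^-1.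
  by rewrite [LHS]mkE !mxE.
pose N := mk 0 c 0 0; pose M := mk 0 0 1 0.
have N2 : N *m N = 0 by rewrite mkM mk0; congr mk; ring.
have M2 : M *m M = 0 by rewrite mkM mk0; congr mk; ring.
apply: (@square_zero_commutator_sim _ _ _
  ((1%:M + N) *m (1%:M + M) *m (1%:M - N) *m (1%:M - M))); last by exists N, M.
have s2 : s ^+ 2 + 1 != 0.
  apply: contraNneq s4 => /eqP; rewrite addr_eq0 => /eqP e.
  by rewrite (exprM s 2 2) e sqrrN expr1n.
(* The inverse of [s + s^-1], the determinant of the change of basis below. *)
pose d := s / (s ^+ 2 + 1).
(* The columns are eigenvectors of the commutator for [s^2] and [s^-2]. *)
exists (mk (s + 1) (1 - s^-1) 1 1).
  have /mulmx1_unit[] : mk d (- d * (1 - s^-1)) (- d) (d * (s + 1)) *m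
      mk (s + 1) (1 - s^-1) 1 1 = 1%:M.
    by rewrite mkM mk1 /d; congr mk; field; rewrite ?s0 ?s2.
  by [].
by rewrite eD mk1 !mkN !mkD !mkM /d /c; congr mk; field; rewrite ?s0 ?s2.
Qed.

(* A new [s] has to avoid [0], the fourth roots of unity and the square roots
   of the [2 j] previous eigenvalues: at most [4 j + 5 < 4 k + 5] values. *)
Lemma exists_square_eigenvalues (F : fieldType) k j :
  card_at_least (4 * k + 5) F -> (j <= k)%N ->
  exists l : seq F, [/\ size l = j.*2, uniq l & 1 \notin l] /\
    [/\ 0 \notin l, {in l, forall x, x^-1 \in l}, \prod_(x <- l) x = 1
      & square_zero_commutator (diag_seq j.*2 l)].
Proof.
move=> [f injf]; elim: j => [_|j IHj jk].
  exists [::]; rewrite big_nil; split=> //; split=> //.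
  have -> : diag_seq 0.*2 [::] = 1%:M :> 'M[F]_0.*2 by apply/matrixP => -[].
  exact: square_zero_commutator1.
have [l [[sl ul l1] [l0 lV pl cl]]] := IHj (ltnW jk).
pose p : {poly F} := 'X * ('X^4 - 1%:P) * \prod_(x <- l) ('X^2 - x%:P).
have X2 x : 'X^2 - x%:P != 0 :> {poly F} by rewrite monic_neq0 ?monicXnsubC.
have X4 : 'X^4 - 1%:P != 0 :> {poly F} by rewrite monic_neq0 ?monicXnsubC.
have Xl : \prod_(x <- l) ('X^2 - x%:P) != 0.
  by rewrite prodf_seq_neq0; apply/allP => x _; rewrite /= X2.
have sp : size p = (6 + 4 * j)%N.
  rewrite /p !size_mul ?mulf_neq0 ?polyX_eq0 // size_polyX size_XnsubC //=.
  rewrite size_prod_seq => [|x _]; last exact: X2.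
  rewrite (eq_bigr (fun=> 3)) => [|x _]; last by rewrite size_XnsubC.
  by rewrite big_const_seq count_predT iter_addn_0 sl; lia.
(* The [4 k + 5] distinct values of [f] outnumber the roots of [p], whose degree is [4 j + 5] with
   [j < k]. *)
have [s sf ps] : exists2 s, s \in codom f & ~~ root p s.
  apply/allPn; apply/negP => /(max_poly_roots _); rewrite sp size_codom card_ord.
  rewrite /p !mulf_neq0 ?polyX_eq0 // => /(_ isT); rewrite map_inj_uniq ?enum_uniq //.
  by move=> /(_ isT); lia.
move: ps; rewrite /root /p !hornerE horner_prod !mulf_eq0 !negb_or.
rewrite subr_eq0 prodf_seq_neq0 => /andP[/andP[s0 s4] /allP sl2].
have sNl : s ^+ 2 \notin l.
  by apply/negP => /sl2; rewrite /= !hornerE subrr eqxx.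
have s20 : s ^+ 2 != 0 by rewrite expf_neq0.
have sVs : s ^+ 2 != (s ^+ 2)^-1.
  apply: contraNneq s4 => e; rewrite (exprM s 2 2) expr2 {1}e mulVf //.
have s21 : s ^+ 2 != 1 by apply: contraNneq s4 => e; rewrite (exprM s 2 2) e expr1n.
(* Closure of [l] under inverses is maintained for this: [s^-2] is new as soon as [s^2] is. *)
have sVNl : (s ^+ 2)^-1 \notin l by apply: contra sNl => /lV; rewrite invrK.
exists [:: s ^+ 2, (s ^+ 2)^-1 & l]; split; split.
- by rewrite /= sl.
- by rewrite /= inE negb_or sVs sNl sVNl.
- by rewrite !inE !negb_or l1 eq_sym s21 eq_sym invr_eq1 s21.
- by rewrite !inE !negb_or l0 eq_sym s20 eq_sym invr_eq0 s20.
- move=> x; rewrite !inE => /or3P[/eqP->|/eqP->|/lV->]; rewrite ?eqxx ?orbT //.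
  by rewrite invrK eqxx.
- by rewrite !big_cons pl mulr1 divff.
have -> : diag_seq j.+1.*2 [:: s ^+ 2, (s ^+ 2)^-1 & l] =
    block_mx (diag_seq 2 [:: s ^+ 2; (s ^+ 2)^-1]) 0 0 (diag_seq j.*2 l).
  by rewrite -diag_seq_cat.
apply: (@square_zero_commutator_block F 2 j.*2) => //.
exact: square_zero_commutator_diag2.
Qed.

(** The pairs fill an even size. In odd size the eigenvalue [1], kept out of the pairs so far, is
    adjoined. *)
Lemma exists_eigenvalues (F : fieldType) n :
  card_at_least (4 * n./2 + 5) F ->
  exists l : seq F, [/\ size l = n, uniq l, 0 \notin l, \prod_(x <- l) x = 1
      & square_zero_commutator (diag_seq n l)].
Proof.
move=> /exists_square_eigenvalues /(_ (leqnn _)) [l [[sl ul l1] [l0 _ pl cl]]].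
case: (boolP (odd n)) (odd_double_half n) => _ /= en; last first.
  by exists l; rewrite -[n]en add0n.
rewrite -en; exists (1 :: l); split=> //=; first by rewrite sl.
- by rewrite l1.
- by rewrite inE negb_or l0 eq_sym oner_eq0.
- by rewrite big_cons pl mulr1.
- rewrite diag_seq_cons; apply: square_zero_commutator_block => //.
  exact: square_zero_commutator1.
Qed.

(** * Scalar matrices over an algebraically closed field *)

Lemma scale_diag_seq (F : fieldType) n (a : F) (l : seq F) : size l = n ->
  a *: diag_seq n l = diag_seq n [seq a * x | x <- l].
Proof.
move=> sl; rewrite /diag_seq -linearZ; congr diag_mx.
by apply/rowP => i; rewrite !mxE (nth_map 0) ?sl.
Qed.

Lemma closed_field_sqrt (F : fieldType) (x : F) :
  GRing.closed_field_axiom F -> exists s, s ^+ 2 = x.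
Proof.
move=> /(_ 2%N (nth 0 [:: x]) isT) [s es]; exists s.
by rewrite es !big_ord_recl big_ord0 /= mulr1 mul0r !addr0.
Qed.

(* The first and last entries form a block [diag x x^-1]; the middle one, if
   any, is its own inverse, hence 1. *)
Lemma square_zero_commutator_palindrome (F : fieldType) (l : seq F) :
  GRing.closed_field_axiom F -> [seq x^-1 | x <- l] = rev l -> 0 \notin l ->
  {in l, forall x, x = -1 -> x = 1} ->
  square_zero_commutator (diag_seq (size l) l).
Proof.
move=> Fcl; have [k] := ubnP (size l); elim: k l => // k IHk.
(* An entry of square [1] is [1]. The hypothesis excludes [-1] only where it differs from [1], so
   that characteristic 2 is covered. *)
have sq1 (l : seq F) x : {in l, forall x, x = -1 -> x = 1} ->
    x \in l -> x ^+ 2 = 1 -> x = 1.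
  by move=> lN xl /eqP; rewrite sqrf_eq1 => /orP[/eqP|/eqP/(lN _ xl)].
case=> [|x l] sk.
  move=> _ _ _.
  have -> : diag_seq 0 [::] = 1%:M :> 'M[F]_0 by apply/matrixP => -[].
  exact: square_zero_commutator1.
case: (lastP l) sk => [|{}l y] sk.
  move=> [xV]; rewrite inE eq_sym => x0 /sq1 /(_ (mem_head _ _)) x1.
  rewrite /= diag_seq1 x1; first exact: square_zero_commutator1.
  by rewrite expr2 -{1}xV mulVf.
rewrite /= map_rcons rev_cons rev_rcons /= => -[xV] /rcons_inj [lV _].
rewrite inE negb_or eq_sym mem_rcons inE negb_or => /and3P[x0 _ l0] lN.
pose l2 := [:: x; x^-1].
have sim : mxsim (diag_seq (2 + size l) (x :: rcons l y))
    (block_mx (diag_seq 2 l2) 0 0 (diag_seq (size l) l)).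
  rewrite -diag_seq_cat //; apply: mxsim_diag_perm.
    by rewrite /= size_rcons.
  by rewrite /l2 /= perm_cons xV perm_rcons.
rewrite size_rcons; apply: square_zero_commutator_sim sim _.
apply: square_zero_commutator_block.
  have [s es] := closed_field_sqrt x Fcl.
  (* If [x^2 = 1] the block is the identity; otherwise [s^4 = x^2] differs from [1]. *)
  have [x2|x2] := eqVneq (x ^+ 2) 1.
    have -> : diag_seq 2 l2 = 1%:M; last exact: square_zero_commutator1.
    rewrite /l2 (sq1 _ _ lN (mem_head _ _) x2) invr1; apply/matrixP => i j.
    by rewrite !mxE; case: i => [[|[|]]].
  rewrite /l2 -es; apply: square_zero_commutator_diag2.
    by apply: contraNneq x0 => e; rewrite -es e expr0n.
  by rewrite (exprM s 2 2) es.
apply: IHk => //; first by move: sk; rewrite /= size_rcons !ltnS; apply: ltnW.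
by move=> z zl; apply: lN; rewrite inE mem_rcons inE zl !orbT.
Qed.

(** One of the two square roots works. If an odd power of [c] is [-1], the same power of [-c] is
    [1]; were another odd power of [-c] equal to [-1], raising it to that exponent would give
    [1 = -1], which is harmless. *)
Lemma exists_odd_sqrt (F : fieldType) n (a : F) :
  GRing.closed_field_axiom F -> exists2 c, c ^+ 2 = a
    & forall j, (j < n)%N -> c ^+ j.*2.+1 = -1 -> c ^+ j.*2.+1 = 1.
Proof.
move=> Fcl; have [c ca] := closed_field_sqrt a Fcl.
have sgn (b : F) j : b ^+ j.*2.+1 = -1 -> (- b) ^+ j.*2.+1 = 1.
  by move=> e; rewrite exprNn e -signr_odd /= odd_double mulrNN mulr1.
have [/existsP[i /eqP ci]|nc] := boolP [exists i : 'I_n, c ^+ i.*2.+1 == -1].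
  exists (- c); rewrite ?sqrrN // => j _ e; rewrite e.
  have := congr1 (fun z => z ^+ i.*2.+1) e.
  rewrite -exprM mulnC exprM (sgn _ _ ci) expr1n => {2}->.
  by rewrite -signr_odd /= odd_double.
exists c => // j jn e; case/existsP: nc; exists (Ordinal jn); exact/eqP.
Qed.

(* [B = diag (c, c^3, ..., c^(2n-1))] with [c^2 = a] is cyclically permuted by
   multiplication by [a], so that [a = (a B) B^-1] with [a B] similar to [B]. *)
Lemma scalar_two_commutators (F : fieldType) n (a : F) :
  GRing.closed_field_axiom F -> (0 < n)%N -> a ^+ n = 1 ->
  exists B C : 'M[F]_n, [/\ square_zero_commutator B, square_zero_commutator C
    & a%:M = B *m C].
Proof.
move=> Fcl n_gt0 an; have [c ca cN] := exists_odd_sqrt n a Fcl.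
have c2n : c ^+ n.*2 = 1 by rewrite -mul2n exprM ca.
pose l := mkseq (fun j => c ^+ j.*2.+1) n.
have sl : size l = n by rewrite size_mkseq.
have c0 : c != 0.
  by apply: contra_eq_neq c2n => ->;
    rewrite expr0n double_eq0 eqn0Ngt n_gt0 eq_sym oner_eq0.
have cB : square_zero_commutator (diag_seq n l).
  suff : square_zero_commutator (diag_seq (size l) l) by rewrite sl.
  apply: square_zero_commutator_palindrome => //.
  (* The exponents [2 i + 1] and [2 (n - 1 - i) + 1] add up to [2 n], so the corresponding entries
     are mutually inverse. *)
  - apply: (@eq_from_nth _ 0) => [|i]; rewrite size_map ?size_rev // sl => i_n.
    rewrite (nth_map 0) ?sl // nth_rev ?sl // !nth_mkseq //; last first.
      by rewrite subnS; lia.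
    apply: (mulfI (expf_neq0 i.*2.+1 c0)); rewrite mulfV ?expf_neq0 //.
    by rewrite -exprD -c2n; congr (_ ^+ _); lia.
  - by apply/mapP => -[j _ /esym/eqP]; rewrite expf_eq0 (negPf c0) andbF.
  - by move=> x /mapP[j]; rewrite mem_iota => jn ->; apply: cN.
have [C cC BC] := square_zero_commutator_inv cB.
exists (a *: diag_seq n l), C; split=> //; last first.
  by rewrite -scalemxAl BC scale_scalar_mx mulr1.
rewrite scale_diag_seq //; apply: square_zero_commutator_sim cB.
apply: mxsim_diag_perm; first by rewrite size_map.
rewrite -map_comp; case: (n) n_gt0 c2n @l {sl cN an C cC BC} => // m _ c2n l.
rewrite {}/l /mkseq -{1}addn1 iotaD map_cat add0n perm_catC /=.
rewrite -[1%N]addn0 iotaDl -map_comp.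
(* With [n = m + 1], the last entry wraps around to the first because [c^(2 n) = 1]. *)
have -> : (a * c ^+ m.*2.+1) = c ^+ 1.
  by rewrite -ca -exprD -[RHS]mul1r -c2n -exprD; congr (_ ^+ _); lia.
rewrite perm_cons (eq_map (g := fun j => c ^+ (1 + j).*2.+1)) // => j /=.
by rewrite -ca -exprD.
Qed.

(** * Decompositions of matrices of determinant 1 *)

Lemma nonscalar_two_commutators (F : fieldType) n (A : 'M[F]_n) :
  (1 < n)%N -> card_at_least (4 * n./2 + 5) F -> ~~ is_scalar_mx A ->
  \det A = 1 ->
  exists B C, [/\ square_zero_commutator B, square_zero_commutator C & A = B *m C].
Proof.
move=> n1 /exists_eigenvalues [l [sl ul l0 pl cl]] nsA dA.
have dl : \det A = (\prod_(x <- l) x) * \prod_(x <- l) x by rewrite pl mulr1.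
have [B [C [eA sB sC]]] :=
  sourour_factorization (ltnW n1) sl sl ul ul l0 l0 dl (fun=> nsA).
by exists B, C; split=> //; [apply: square_zero_commutator_sim sB cl
  | apply: square_zero_commutator_sim sC cl].
Qed.

Lemma scalar_three_commutators (F : fieldType) n (A : 'M[F]_n) :
  (1 < n)%N -> card_at_least (4 * n./2 + 5) F -> is_scalar_mx A ->
  \det A = 1 ->
  exists B C D, [/\ square_zero_commutator B, square_zero_commutator C,
    square_zero_commutator D & A = B *m C *m D].
Proof.
move=> n1 cF /is_scalar_mxP[a ->] dA.
have [l [sl ul l0 pl cl]] := exists_eigenvalues cF.
have [D cD lD] := square_zero_commutator_inv cl.
have a0 : a != 0.
  by apply: contra_eq_neq dA => ->;
    rewrite det_scalar expr0n eqn0Ngt (ltnW n1) eq_sym oner_eq0.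
have [||B [C [cB cC eBC]]] :=
  @nonscalar_two_commutators F n (a%:M *m diag_seq n l) n1 cF.
- apply: contra (diag_seq_nonscalar n1 sl ul) => /is_scalar_mxP[b eb].
  apply/is_scalar_mxP; exists (a^-1 * b).
  rewrite mul_scalar_mx in eb.
  by rewrite -scale_scalar_mx -eb scalerA mulVf // scale1r.
- by rewrite det_mulmx dA det_diag_seq // pl mulr1.
by exists B, C, D; split; rewrite // -eBC -mulmxA lD mulmx1.
Qed.

(** * Passage to commutators and products of [U2_matrix] factors *)

(** Only the condition that both matrices differ from the identity is at stake. If [A] is not [1],
    neither [N] nor [M] can vanish. If [A] is [1], it is [[X, X]] for a transvection [X], which
    exists since [n > 1]. *)
Lemma U2_commutator_of_square_zero (F : fieldType) n (A : 'M[F]_n) :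
  (1 < n)%N -> square_zero_commutator A -> U2_commutator A.
Proof.
move=> n1 [N [M [N2 M2 eA]]].
have inv (X : 'M[F]_n) : X *m X = 0 ->
    (1%:M + X \in unitmx) * (invmx (1%:M + X) = 1%:M - X).
  move=> /mulmx_unipotent XX; have [uX _] := mulmx1_unit XX.
  by rewrite uX -[RHS](mulKmx uX) XX mulmx1.
have U2 (X : 'M[F]_n) : X *m X = 0 -> X != 0 -> U2_matrix (1%:M + X).
  move=> X2 X0; split; first by rewrite addrC addKr expr2.
  by move/eqP; rewrite -subr_eq0 addrC addKr (negPf X0).
have [A1|A1] := eqVneq A 1%:M.
  case: n n1 A A1 {N M N2 M2 eA} inv U2 => [|[|n]] // _ A A1 inv U2.
  pose X : 'M[F]_n.+2 := delta_mx 0 1.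
  have X2 : X *m X = 0 by rewrite mul_delta_mx_0.
  have X0 : X != 0.
    apply/eqP => /matrixP/(_ 0 1); rewrite !mxE !eqxx; exact/eqP/oner_neq0.
  exists (1%:M + X), (1%:M + X); split; rewrite ?A1; [exact: U2|exact: U2|].
  by rewrite /mx_commutator mulmxK ?mulmxV ?inv.
have N0 : N != 0.
  apply: contraNneq A1 => N0; rewrite eA N0 addr0 subr0 mul1mx mulmx1.
  by rewrite mulmx_unipotent.
have M0 : M != 0.
  apply: contraNneq A1 => M0; rewrite eA M0 addr0 subr0 !mulmx1.
  by rewrite mulmx_unipotent.
exists (1%:M + N), (1%:M + M); split; [exact: U2|exact: U2|].
by rewrite /mx_commutator !inv.
Qed.

(* [[X, Y] = X (Y X^-1 Y^-1)]. *)
Lemma U2_commutator_factor (F : fieldType) n (A : 'M[F]_n) :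
  U2_commutator A ->
  exists X Y, [/\ U2_matrix X, U2_matrix Y & A = X *m Y].
Proof.
case=> X [Y [[X2 X1] [Y2 Y1] ->]].
have unip (Z : 'M[F]_n) : (Z - 1%:M) ^+ 2 = 0 -> Z \in unitmx.
  rewrite expr2 -[Z in Z \in _](subrKC 1%:M) => /mulmx_unipotent.
  by case/mulmx1_unit.
have uX := unip _ X2; have uY := unip _ Y2.
exists X, (Y *m invmx X *m invmx Y); split; [by []| |by rewrite /mx_commutator !mulmxA].
(* In this form the square vanishes, because [X^-1] commutes with [X - 1]. *)
have e : Y *m invmx X *m invmx Y - 1%:M = - (Y *m invmx X *m (X - 1%:M) *m invmx Y).
  rewrite mulmxBr mulmxKV // mulmx1 mulmxBl mulmxV //.
  by rewrite opprB.
split.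
  have cX : (X - 1%:M) *m invmx X = invmx X *m (X - 1%:M).
    by rewrite mulmxBl mulmxBr mulmxV // mulVmx // mul1mx mulmx1.
  rewrite e sqrrN expr2 -!mulmxE !mulmxA mulmxKV //.
  rewrite -(mulmxA _ _ (invmx X)) cX -!mulmxA (mulmxA (X - 1%:M) (X - 1%:M)).
  by rewrite [(X - _) *m (X - _)]X2 !(mul0mx, mulmx0).
(* If the conjugate [Y X^-1 Y^-1] were [1], then [X] would be [1]. *)
move=> /(congr1 (fun Z => Z *m Y *m X)); rewrite mulmxKV // mulmxKV // mul1mx.
by move=> /esym/(congr1 (mulmx (invmx Y))); rewrite mulVmx // mulKmx.
Qed.

Lemma product_of_U2_matrices (F : fieldType) n k (A : 'M[F]_n) :
  product_of_at_most k (@U2_commutator F n) A ->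
  product_of_at_most k.*2 (@U2_matrix F n) A.
Proof.
case=> s [/andP[s0 sk] cs ->].
suff [t [st ct et]] : exists t, [/\ size t = (size s).*2, {in t, forall X, U2_matrix X}
    & \big[mulmx/1%:M]_(X <- s) X = \big[mulmx/1%:M]_(X <- t) X].
  by exists t; rewrite st leq_double sk double_gt0 s0.
elim: s cs {s0 sk} => [|A0 s IHs] cs; first by exists [::]; rewrite !big_nil.
have [t [st ct et]] := IHs (fun X Xs => cs X (mem_behead (s := A0 :: s) Xs)).
have [X [Y [uX uY eA]]] := U2_commutator_factor (cs A0 (mem_head _ _)).
exists [:: X, Y & t]; split; first by rewrite /= st.
  by move=> Z; rewrite !inE => /or3P[/eqP->|/eqP->|/ct].
by rewrite !big_cons et eA mulmxA.
Qed.

Lemma product_of_at_most_seq (F : fieldType) n k (s : seq 'M[F]_n) :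
  (1 < n)%N -> (0 < size s <= k)%N -> {in s, forall X, square_zero_commutator X} ->
  product_of_at_most k (@U2_commutator F n) (\big[mulmx/1%:M]_(X <- s) X).
Proof.
move=> n1 sk cs; exists s; split=> // X /cs; exact: U2_commutator_of_square_zero.
Qed.

Theorem theorem5p5 (n : nat) (F : fieldType)
    (hn : (2 <= n)%N) (hF : card_at_least (4 * n./2 + 5) F) :
  (forall A : 'M[F]_n, \det A = 1 ->
     product_of_at_most 3 (@U2_commutator F n) A /\
     product_of_at_most 6 (@U2_matrix F n) A) /\
  (GRing.closed_field_axiom F ->
   forall A : 'M[F]_n, \det A = 1 ->
     product_of_at_most 2 (@U2_commutator F n) A /\
     product_of_at_most 4 (@U2_matrix F n) A).
Proof.
(* The bound [k] is left free because nonscalar matrices need two factors in both halves, where the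
   bounds are 3 and 2. *)
have two k (A B C : 'M[F]_n) : (2 <= k)%N -> square_zero_commutator B ->
    square_zero_commutator C -> A = B *m C ->
    product_of_at_most k (@U2_commutator F n) A.
  move=> k2 cB cC ->.
  have -> : B *m C = \big[mulmx/1%:M]_(X <- [:: B; C]) X.
    by rewrite !big_cons big_nil mulmx1.
  by apply: product_of_at_most_seq => // X; rewrite !inE => /orP[]/eqP->.
split=> [|Fcl] A dA.
  suff p3 : product_of_at_most 3 (@U2_commutator F n) A.
    by split=> //; apply: (product_of_U2_matrices p3).
  have [sA|nsA] := boolP (is_scalar_mx A); last first.
    have [B [C [cB cC eA]]] := nonscalar_two_commutators hn hF nsA dA.
    exact: two eA.
  have [B [C [D [cB cC cD ->]]]] := scalar_three_commutators hn hF sA dA.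
  have -> : B *m C *m D = \big[mulmx/1%:M]_(X <- [:: B; C; D]) X.
    by rewrite !big_cons big_nil mulmx1 mulmxA.
  by apply: product_of_at_most_seq => // X; rewrite !inE => /or3P[]/eqP->.
suff p2 : product_of_at_most 2 (@U2_commutator F n) A.
  by split=> //; apply: (product_of_U2_matrices p2).
have [/is_scalar_mxP[a eA]|nsA] := boolP (is_scalar_mx A); last first.
  have [B [C [cB cC eA]]] := nonscalar_two_commutators hn hF nsA dA.
  exact: two eA.
have an : a ^+ n = 1 by rewrite -det_scalar -eA.
have [B [C [cB cC eBC]]] := scalar_two_commutators Fcl (ltnW hn) an.
by apply: two cB cC _ => //; rewrite eA.
Qed.
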